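(* Let $k$ be an algebraically closed field, let $A$ be a finite-dimensional $k$-algebra, and let $\Gamma$ be a connected component of the Auslander-Reiten quiver of $A$ which is mesh-comparable via $F$. Let $f_1:X_0\to X_1,\ldots,f_n:X_{n-1}\to X_n$ be chosen irreducible morphisms between modules in $\Gamma$. Then either $f_n\cdots f_1\in\operatorname{rad}^n(X_0,X_n)\setminus\operatorname{rad}^{n+1}(X_0,X_n)$ or $f_n\cdots f_1=0$.
   Context: Algebras are associative and unital; $\operatorname{mod} A$ is the category of finitely generated right $A$-modules. The radical $\operatorname{rad}_A$ is the ideal of $\operatorname{mod} A$ such that for $X,Y$ indecomposable $\operatorname{rad}_A(X,Y)$ is the set of non-isomorphisms $X\to Y$, extended to direct sums componentwise; $\operatorname{rad}^0=\operatorname{Hom}_A$, $\operatorname{rad}^n=\operatorname{rad}^{n-1}\cdot\operatorname{rad}$. The Auslander-Reiten quiver of $A$ has as vertices the isomorphism classes of indecomposable $A$-modules, and $\dim_k \operatorname{rad}(M,N)/\operatorname{rad}^2(M,N)$ arrows from $M$ to $N$. A connected component $\Gamma$ is a translation quiver with the Auslander-Reiten translation $\tau$: for every non-projective vertex $x$ and every vertex $y$ a bijection $\alpha\mapsto\sigma(\alpha)$ from arrows $y\to x$ to arrows $\tau x\to y$ is fixed. Vertices of $\Gamma$ are identified with (fixed representatives of) indecomposable modules; $\operatorname{ind}\Gamma$ is the full subcategory of $\operatorname{mod} A$ given by the indecomposable modules in $\Gamma$. The path category $k\Gamma$ has the vertices of $\Gamma$ as objects, and as morphisms $x\to y$ the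 formal $k$-linear combinations of paths from $x$ to $y$. The mesh category $k(\Gamma)$ is the quotient of $k\Gamma$ by the ideal generated by the mesh relations $\sum \alpha\,\sigma(\alpha):\tau x\to x$, where $x$ is non-projective and the sum runs over all arrows $\alpha$ ending at $x$; $\overline{\alpha}$ is the class of an arrow $\alpha$. A Riedtmann functor is a $k$-linear functor $F:k(\Gamma)\to\operatorname{ind}\Gamma$ such that for every vertex $X$: (1) $FX=X$; (2) if $\alpha_i:X\to X_i$, $1\le i\le r$, are all the arrows starting at $X$, then $[F(\overline{\alpha_1})\ \cdots\ F(\overline{\alpha_r})]^t:X\to X_1\oplus\cdots\oplus X_r$ is left minimal almost split; (3) if $\alpha_i:X_i\to X$, $1\le i\le r$, are all the arrows ending at $X$, then $[F(\overline{\alpha_1})\ \cdots\ F(\overline{\alpha_r})]:X_1\oplus\cdots\oplus X_r\to X$ is right minimal almost split. $\Gamma$ is mesh-comparable via $F$ if $F:k(\Gamma)\to\operatorname{ind}\Gamma$ is a Riedtmann functor. In that case, a chosen (irreducible) morphism is a morphism of the form $F(\overline{\alpha}):X\to Y$ for an arrow $\alpha:X\to Y$ of $\Gamma$. *)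

(* Defs.v *)
From HB Require Import structures.
From mathcomp Require Import all_boot all_algebra all_field.
From mathcomp Require Import finmap monalg.

Set Implicit Arguments.
Unset Strict Implicit.
Unset Printing Implicit Defensive.

Import GRing.Theory.
Local Open Scope ring_scope.

(* Finitely generated modules over a finite-dimensional K-algebra A.          *)
(* Over such an algebra these are exactly the modules of finite dimension     *)
(* over K, hence the vectType carriers.  The action is a linear map           *)
(* A -> End_K(M), i.e. a K-bilinear map.                                      *)

Record rightMod (K : fieldType) (A : falgType K) := RightMod {
  rm_sort :> vectType K;
  ract : 'Hom(A, 'End(rm_sort));  (* ract a m stands for m a *)
  ract1 : forall m : rm_sort, ract 1 m = m;
  ractM : forall (a b : A) (m : rm_sort), ract (a * b) m = ract b (ract a m)
}.
Arguments ract {K A} r.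

Record leftMod (K : fieldType) (A : falgType K) := LeftMod {
  lm_sort :> vectType K;
  lact : 'Hom(A, 'End(lm_sort));  (* lact a m stands for a m *)
  lact1 : forall m : lm_sort, lact 1 m = m;
  lactM : forall (a b : A) (m : lm_sort), lact (a * b) m = lact a (lact b m)
}.
Arguments lact {K A} l.

Section RegularModule.
Variables (K : fieldType) (A : falgType K).

Definition reg_act : 'Hom(A, 'End(A)) := linfun (@amulr K A).

Lemma reg_actE (a x : A) : reg_act a x = x * a.
Proof. by rewrite /reg_act lfunE /= lfunE. Qed.

Fact reg_act1 (x : A) : reg_act 1 x = x.
Proof. by rewrite reg_actE mulr1. Qed.

Fact reg_actM (a b x : A) : reg_act (a * b) x = reg_act b (reg_act a x).
Proof. by rewrite !reg_actE mulrA. Qed.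

Definition regMod : rightMod A := RightMod reg_act1 reg_actM.

End RegularModule.
Arguments regMod {K} A.

Section DualModule.
Variables (K : fieldType) (A : falgType K) (L : leftMod A).

Let D : vectType K := 'Hom(L, K^o).

Definition dual_act1 (a : A) (phi : D) : D := (phi \o lact L a)%VF.

Fact dual_act1_is_linear a : linear (dual_act1 a).
Proof.
move=> c f g; apply/lfunP=> x.
by rewrite /dual_act1 !(comp_lfunE, add_lfunE, scale_lfunE).
Qed.

HB.instance Definition _ a := GRing.isSemilinear.Build K D D _ (dual_act1 a)
  (GRing.semilinear_linear (dual_act1_is_linear a)).

Definition dual_act2 (a : A) : 'End(D) := linfun (dual_act1 a).

Lemma dual_act2E (a : A) (phi : D) (x : L) : dual_act2 a phi x = phi (lact L a x).
Proof. by rewrite /dual_act2 lfunE /= comp_lfunE. Qed.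

Fact dual_act2_is_linear : linear dual_act2.
Proof.
move=> c a b; apply/lfunP=> phi; apply/lfunP=> x.
rewrite !(add_lfunE, scale_lfunE) !dual_act2E.
by rewrite linearP add_lfunE scale_lfunE linearP.
Qed.

HB.instance Definition _ := GRing.isSemilinear.Build K A 'End(D) _ dual_act2
  (GRing.semilinear_linear dual_act2_is_linear).

Definition dual_act : 'Hom(A, 'End(D)) := linfun dual_act2.

Lemma dual_actE (a : A) (phi : D) (x : L) : dual_act a phi x = phi (lact L a x).
Proof. by rewrite /dual_act lfunE /= dual_act2E. Qed.

Fact dual_actK1 (phi : D) : dual_act 1 phi = phi.
Proof. by apply/lfunP=> x; rewrite dual_actE lact1. Qed.

Fact dual_actKM (a b : A) (phi : D) :
  dual_act (a * b) phi = dual_act b (dual_act a phi).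
Proof. by apply/lfunP=> x; rewrite !dual_actE lactM. Qed.

Definition dualMod : rightMod A := RightMod dual_actK1 dual_actKM.

End DualModule.

Section ModA.
Variables (K : fieldType) (A : falgType K).
Implicit Types M N P X Y E : rightMod A.

Definition is_hom M N (f : 'Hom(M, N)) : Prop :=
  forall (a : A) (m : M), f (ract M a m) = ract N a (f m).

Definition is_iso M N (f : 'Hom(M, N)) : Prop :=
  is_hom f /\ exists g : 'Hom(N, M),
    [/\ is_hom g, (g \o f = \1)%VF & (f \o g = \1)%VF].

Definition isomorphic M N : Prop := exists f : 'Hom(M, N), is_iso f.

Definition is_section M N (f : 'Hom(M, N)) : Prop :=
  exists g : 'Hom(N, M), is_hom g /\ (g \o f = \1)%VF.

Definition is_retraction M N (f : 'Hom(M, N)) : Prop :=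
  exists g : 'Hom(N, M), is_hom g /\ (f \o g = \1)%VF.

Definition is_submod M (U : {vspace M}) : Prop :=
  forall (a : A) (m : M), m \in U -> ract M a m \in U.

Definition indecomposable M : Prop :=
  (exists m : M, m != 0) /\
  forall U V : {vspace M}, is_submod U -> is_submod V ->
    (U + V = fullv)%VS -> (U :&: V = 0)%VS -> U = 0%VS \/ V = 0%VS.

(* E is the direct sum of X_0, ..., X_(r-1), with injections i_ and           *)
(* projections p_.                                                            *)
Definition is_dsum E (r : nat) (X_ : 'I_r -> rightMod A)
    (i_ : forall i, 'Hom(X_ i, E)) (p_ : forall i, 'Hom(E, X_ i)) : Prop :=
  [/\ forall i, is_hom (i_ i) /\ is_hom (p_ i),
      forall i, (p_ i \o i_ i = \1)%VF,
      forall i j, i != j -> (p_ j \o i_ i = 0)%VF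
    & (\sum_i (i_ i \o p_ i) = \1)%VF].

Definition rad X Y (f : 'Hom(X, Y)) : Prop :=
  is_hom f /\
  exists (r : nat) (X_ : 'I_r -> rightMod A)
         (i_ : forall i, 'Hom(X_ i, X)) (p_ : forall i, 'Hom(X, X_ i))
         (s : nat) (Y_ : 'I_s -> rightMod A)
         (j_ : forall j, 'Hom(Y_ j, Y)) (q_ : forall j, 'Hom(Y, Y_ j)),
    [/\ is_dsum i_ p_ /\ (forall i, indecomposable (X_ i)),
        is_dsum j_ q_ /\ (forall j, indecomposable (Y_ j))
      & forall i j, ~ is_iso (q_ j \o (f \o i_ i))%VF].

(* The product of two ideals consists of finite sums of composites. *)
Fixpoint radn (n : nat) X Y (f : 'Hom(X, Y)) : Prop :=
  if n is n'.+1 then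
    exists (r : nat) (Z : 'I_r -> rightMod A)
           (h : forall i, 'Hom(X, Z i)) (g : forall i, 'Hom(Z i, Y)),
      [/\ forall i, rad (h i), forall i, radn n' (g i)
        & f = (\sum_i (g i \o h i))%VF]
  else is_hom f.

(* d is the dimension of P / Q, where Q <= P are linear subspaces of V. *)
Definition quot_dim (V : vectType K) (P Q : V -> Prop) (d : nat) : Prop :=
  exists b : 'I_d -> V,
    [/\ forall i, P (b i),
        forall v, P v -> exists c : 'I_d -> K, Q (v - \sum_i c i *: b i)
      & forall c : 'I_d -> K, Q (\sum_i c i *: b i) -> forall i, c i = 0].

Definition arrow_count M N (d : nat) : Prop :=
  quot_dim (@rad M N) (@radn 2 M N) d.

Definition left_almost_split X E (f : 'Hom(X, E)) : Prop :=
  [/\ is_hom f, ~ is_section f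
    & forall Y (u : 'Hom(X, Y)), is_hom u -> ~ is_section u ->
        exists v : 'Hom(E, Y), is_hom v /\ (v \o f = u)%VF].

Definition left_minimal X E (f : 'Hom(X, E)) : Prop :=
  forall h : 'End(E), is_hom (h : 'Hom(E, E)) -> (h \o f = f)%VF ->
    is_iso (h : 'Hom(E, E)).

Definition right_almost_split E X (f : 'Hom(E, X)) : Prop :=
  [/\ is_hom f, ~ is_retraction f
    & forall Y (u : 'Hom(Y, X)), is_hom u -> ~ is_retraction u ->
        exists v : 'Hom(Y, E), is_hom v /\ (f \o v = u)%VF].

Definition right_minimal E X (f : 'Hom(E, X)) : Prop :=
  forall h : 'End(E), is_hom (h : 'Hom(E, E)) -> (f \o h = f)%VF ->
    is_iso (h : 'Hom(E, E)).

Definition left_minimal_almost_split X E (f : 'Hom(X, E)) : Prop :=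
  left_minimal f /\ left_almost_split f.

Definition right_minimal_almost_split E X (f : 'Hom(E, X)) : Prop :=
  right_minimal f /\ right_almost_split f.

Definition projective P : Prop :=
  forall X Y (g : 'Hom(X, Y)) (f : 'Hom(P, Y)),
    is_hom g -> limg g = fullv -> is_hom f ->
    exists f' : 'Hom(P, X), is_hom f' /\ (g \o f' = f)%VF.

Definition superfluous M (U : {vspace M}) : Prop :=
  forall V : {vspace M}, is_submod V -> (U + V = fullv)%VS -> V = fullv.

(* P1 --p1--> P0 --p0--> M --> 0 *)
Definition minimal_presentation P1 P0 M (p1 : 'Hom(P1, P0)) (p0 : 'Hom(P0, M))
    : Prop :=
  [/\ projective P1 /\ projective P0,
      is_hom p1 /\ is_hom p0,
      limg p0 = fullv,
      limg p1 = lker p0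
    & superfluous (lker p0) /\ superfluous (lker p1)].

(* L is Tr M, the cokernel of Hom_A(p1, A) : Hom_A(P0, A) -> Hom_A(P1, A) as a *)
(* left A-module, where (a h)(x) = a * h(x).  The quotient map q is a K-linear *)
(* map on all of Hom_K(P1, A), of which only the restriction to Hom_A(P1, A)   *)
(* is used.                                                                    *)
Definition is_transpose M (L : leftMod A) : Prop :=
  exists P1 P0 (p1 : 'Hom(P1, P0)) (p0 : 'Hom(P0, M))
         (q : 'Hom('Hom(P1, regMod A), L)),
    [/\ minimal_presentation p1 p0,
        forall l : L, exists h : 'Hom(P1, regMod A), is_hom h /\ q h = l,
        forall h : 'Hom(P1, regMod A), is_hom h ->
          (q h = 0 <->
           exists g : 'Hom(P0, regMod A), is_hom g /\ h = (g \o p1)%VF)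
      & forall (a : A) (h : 'Hom(P1, regMod A)), is_hom h ->
          q (amull a \o h)%VF = lact L a (q h)].

Definition is_AR_translate M N : Prop :=
  exists L : leftMod A, is_transpose M L /\ isomorphic (dualMod L) N.

End ModA.

(* A connected component of the Auslander-Reiten quiver of A, with chosen     *)
(* representatives of the isomorphism classes and its structure of (locally   *)
(* finite) translation quiver.  The arrows x -> y are the elements of         *)
(* 'I_(narr x y), and ar_tau is partial, undefined exactly at the projective  *)
(* vertices.                                                                  *)

Record AR_component (K : fieldType) (A : falgType K) := ARComponent {
  vertex :> choiceType;
  vmod : vertex -> rightMod A;
  vmod_indec : forall x, indecomposable (vmod x);
  vmod_inj : forall x y, isomorphic (vmod x) (vmod y) -> x = y;
  narr : vertex -> vertex -> nat;
  narrP : forall x y, arrow_count (vmod x) (vmod y) (narr x y);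
  ar_inhabited : inhabited vertex;
  ar_connected : forall x y : vertex, exists s : seq vertex,
    path (fun u v => (0 < narr u v)%N || (0 < narr v u)%N) x s /\ last x s = y;
  ar_saturated : forall (x : vertex) (N : rightMod A) (d : nat),
    indecomposable N -> (0 < d)%N ->
    arrow_count (vmod x) N d \/ arrow_count N (vmod x) d ->
    exists y, isomorphic (vmod y) N;
  ar_out_finite : forall x : vertex,
    exists (r : nat) (e : 'I_r -> {y : vertex & 'I_(narr x y)}), bijective e;
  ar_in_finite : forall x : vertex,
    exists (r : nat) (e : 'I_r -> {y : vertex & 'I_(narr y x)}), bijective e;
  ar_tau : vertex -> option vertex;
  ar_tau_proj : forall x, ar_tau x = None <-> projective (vmod x);
  ar_tauP : forall x z, ar_tau x = Some z -> is_AR_translate (vmod x) (vmod z);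
  ar_sigma : forall x z, ar_tau x = Some z ->
    forall y, 'I_(narr y x) -> 'I_(narr z y);
  ar_sigma_bij : forall x z (e : ar_tau x = Some z) y,
    bijective (ar_sigma e (y := y))
}.
Arguments narr {K A a} x y.
Arguments vmod {K A a} x.

Section MeshCategory.
Variables (K : fieldType) (A : falgType K) (G : AR_component A).

Definition arr (x y : G) := 'I_(narr x y).

Definition arrow := {x : G & {y : G & arr x y}}.
Definition arrow_src (a : arrow) : G := tag a.
Definition arrow_tgt (a : arrow) : G := tag (tagged a).

Definition mkArrow (x y : G) (a : arr x y) : arrow :=
  Tagged (fun x => {y : G & arr x y}) (Tagged (fun y => arr x y) a).

Fixpoint is_walk (x : G) (s : seq arrow) (y : G) : bool :=
  if s is a :: s' then (arrow_src a == x) && is_walk (arrow_tgt a) s' y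
  else x == y.

(* Arrows are listed from the source x to the target y. *)
Definition qpath (x y : G) := {s : seq arrow | is_walk x s y}.

Fact is_walk_nil x : is_walk x [::] x.
Proof. exact: eqxx. Qed.

Fact is_walk_arr x y (a : arr x y) : is_walk x [:: mkArrow a] y.
Proof. by rewrite /= /arrow_src /arrow_tgt /= !eqxx. Qed.

Fact is_walk_cat x y z s t : is_walk x s y -> is_walk y t z ->
  is_walk x (s ++ t) z.
Proof.
elim: s x => [|a s IHs] x /= => [/eqP-> //|/andP[-> Hs] Ht] /=.
exact: IHs Hs Ht.
Qed.

Definition path_nil (x : G) : qpath x x := exist _ [::] (is_walk_nil x).

Definition path_arr (x y : G) (a : arr x y) : qpath x y :=
  exist _ [:: mkArrow a] (is_walk_arr a).

Definition path_cat (x y z : G) (p : qpath x y) (q : qpath y z) : qpath x z :=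
  exist _ (val p ++ val q) (is_walk_cat (valP p) (valP q)).

(* The path category: finitely supported K-valued functions on paths. *)
Definition pathHom (x y : G) := {malg K[qpath x y]}.

Definition pathId (x : G) : pathHom x x := << 1 *g path_nil x >>.

Definition pathArr (x y : G) (a : arr x y) : pathHom x y := << 1 *g path_arr a >>.

(* first u, then v *)
Definition pathComp (x y z : G) (u : pathHom x y) (v : pathHom y z) : pathHom x z :=
  \sum_(p <- msupp u) \sum_(q <- msupp v) << u@_p * v@_q *g path_cat p q >>.

(* The mesh ending at x; e enumerates all the arrows ending at x. *)
Definition mesh_rel (x z : G) (tx : ar_tau x = Some z) (r : nat)
    (e : 'I_r -> {y : G & arr y x}) : pathHom z x :=
  \sum_i pathComp (pathArr (ar_sigma tx (tagged (e i)) : arr z (tag (e i))))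
               (pathArr (tagged (e i))).

Inductive mesh_ideal : forall x y : G, pathHom x y -> Prop :=
| mesh_ideal_rel (x z : G) (tx : ar_tau x = Some z) (r : nat)
    (e : 'I_r -> {y : G & arr y x}) :
    bijective e -> mesh_ideal (mesh_rel tx e)
| mesh_ideal0 (x y : G) : mesh_ideal (0 : pathHom x y)
| mesh_idealP (x y : G) (c : K) (u v : pathHom x y) :
    mesh_ideal u -> mesh_ideal v -> mesh_ideal (c *: u + v)
| mesh_ideal_compl (x y z : G) (u : pathHom x y) (v : pathHom y z) :
    mesh_ideal v -> mesh_ideal (pathComp u v)
| mesh_ideal_compr (x y z : G) (u : pathHom x y) (v : pathHom y z) :
    mesh_ideal u -> mesh_ideal (pathComp u v).

(* Equality of morphisms in the mesh category, whose morphisms are            *)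
(* represented by morphisms of the path category.                             *)
Definition mesh_eq (x y : G) (u v : pathHom x y) : Prop := mesh_ideal (u - v).

(* A K-linear functor from the mesh category to ind G, equal to vmod on       *)
(* objects, with the two almost splitting conditions.                         *)
Record riedtmann_functor := RiedtmannFunctor {
  rf :> forall x y : G, pathHom x y -> 'Hom(vmod x, vmod y);
  rf_mesh : forall (x y : G) (u v : pathHom x y), mesh_eq u v -> rf u = rf v;
  rf_hom : forall (x y : G) (u : pathHom x y), is_hom (rf u);
  rf_linear : forall (x y : G) (c : K) (u v : pathHom x y),
    rf (c *: u + v) = c *: rf u + rf v;
  rf_id : forall x : G, rf (pathId x) = \1%VF;
  rf_comp : forall (x y z : G) (u : pathHom x y) (v : pathHom y z),
    rf (pathComp u v) = (rf v \o rf u)%VF;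
  rf_left : forall (x : G) (r : nat) (e : 'I_r -> {y : G & arr x y}),
    bijective e ->
    exists (E : rightMod A) (i_ : forall i, 'Hom(vmod (tag (e i)), E))
           (p_ : forall i, 'Hom(E, vmod (tag (e i)))),
      is_dsum i_ p_ /\
      left_minimal_almost_split (\sum_i (i_ i \o rf (pathArr (tagged (e i)))))%VF;
  rf_right : forall (x : G) (r : nat) (e : 'I_r -> {y : G & arr y x}),
    bijective e ->
    exists (E : rightMod A) (i_ : forall i, 'Hom(vmod (tag (e i)), E))
           (p_ : forall i, 'Hom(E, vmod (tag (e i)))),
      is_dsum i_ p_ /\
      right_minimal_almost_split (\sum_i (rf (pathArr (tagged (e i))) \o p_ i))%VF
}.

Definition chosen (F : riedtmann_functor) (x y : G) (f : 'Hom(vmod x, vmod y))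
    : Prop :=
  exists a : arr x y, f = F x y (pathArr a).

(* f_(n-1) \o ... \o f_0 *)
Fixpoint comp_chain (X : nat -> G)
    (f : forall i, 'Hom(vmod (X i), vmod (X i.+1))) (n : nat)
    : 'Hom(vmod (X 0%N), vmod (X n)) :=
  if n is n'.+1 then (f n' \o comp_chain f n')%VF else \1%VF.

End MeshCategory.

(* Main.v *)
Require Import Defs.
From HB Require Import structures.
From mathcomp Require Import all_boot all_algebra all_field.
From mathcomp Require Import finmap monalg.
From Stdlib Require Import Classical_Prop.

Set Implicit Arguments.
Unset Strict Implicit.
Unset Printing Implicit Defensive.

Import GRing.Theory.
Local Open Scope ring_scope.

(** Why the theorem holds.  Grade the maps between modules of the component by
    the number of chosen factors: [homog n] is the span of the composites of n
    chosen maps.  A composite of n chosen maps is homogeneous of degree n, hence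
    lies in rad^n, and the theorem is the case of a single composite of
    [homog_separation]: a homogeneous map of degree n lying in rad^(n+1) is
    zero.

    This is proved by induction on n.  Let f : x -> y be homogeneous of degree
    n + 1, so f = g W where g : E -> y is the right minimal almost split map
    made of the chosen maps into y, and the components of W : x -> E are
    homogeneous of degree n.  If f is in rad^(n+2), then also f = g t with t in
    rad^(n+1) ([radnS_factor]), so W - t lands in the kernel of g.

    If y is projective, then g is injective
    ([right_minimal_almost_split_projective]); thus W = t, and the induction
    hypothesis kills the components of W.

    Otherwise the kernel of g is the image of the left minimal almost split map
    phi : tau y -> E made of the chosen maps leaving tau y ([mesh_exact]), so
    W - t = phi s for some s : x -> tau y.  Modulo rad^(n+1), s is a sum of
    homogeneous maps s_0, s_1, ... of degrees 0, 1, ...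
    ([graded_approximation]; this is where the algebraically closed field
    enters).  The components of W - phi s are in rad^(n+1); by induction,
    homogeneous maps of different degrees at most n are independent modulo
    rad^(n+1) ([graded_independent]), so the parts of degree n must cancel:
    W = phi s_(n-1), where s_(-1) = 0.  Hence f = g phi s_(n-1), which is zero
    by the mesh relation.

    The exactness of tau y -> E -> y is forced as soon as phi is left minimal
    almost split, g is right minimal almost split and surjective, and g phi = 0
    ([almost_split_exact]); g is surjective because y is not projective
    ([right_almost_split_onto]), and g phi = 0 is the mesh relation.

    The definition of the radical by decompositions into indecomposables hides
    its closure under sums and composition, hence also that a map in rad^n with
    n > 0 is never a retraction onto a nonzero module.  The intrinsic
    description [jrad] has these properties, and it contains the radical by
    Fitting's lemma ([rad_jrad]). *)

(* The radical of the module category, not that of a sesquilinear form. *)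
Local Notation rad := Defs.rad.

Definition lfE :=
  (comp_lfunE, add_lfunE, opp_lfunE, scale_lfunE, id_lfunE, zero_lfunE).

(** * Homomorphisms and submodules *)

Section Modules.
Variables (K : fieldType) (A : falgType K).
Implicit Types M N P W X Y E Z : rightMod A.

Lemma is_hom0 M N : is_hom (0 : 'Hom(M, N)).
Proof. by move=> a m; rewrite !lfE linear0. Qed.

Lemma is_hom1 M : is_hom (\1%VF : 'Hom(M, M)).
Proof. by move=> a m; rewrite !lfE. Qed.

Lemma is_homD M N (f g : 'Hom(M, N)) : is_hom f -> is_hom g -> is_hom (f + g).
Proof. by move=> hf hg a m; rewrite !lfE hf hg linearD. Qed.

Lemma is_homZ M N c (f : 'Hom(M, N)) : is_hom f -> is_hom (c *: f).
Proof. by move=> hf a m; rewrite !lfE hf linearZ. Qed.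

Lemma is_homN M N (f : 'Hom(M, N)) : is_hom f -> is_hom (- f).
Proof. by move=> hf a m; rewrite !lfE hf linearN. Qed.

Lemma is_homB M N (f g : 'Hom(M, N)) : is_hom f -> is_hom g -> is_hom (f - g).
Proof. by move=> hf hg; apply: is_homD => //; apply: is_homN. Qed.

Lemma is_hom_comp M N P (g : 'Hom(N, P)) (f : 'Hom(M, N)) :
  is_hom g -> is_hom f -> is_hom (g \o f)%VF.
Proof. by move=> hg hf a m; rewrite !lfE hf hg. Qed.

Lemma is_hom_sum M N (I : Type) (r : seq I) (Q : pred I) (f : I -> 'Hom(M, N)) :
  (forall i, is_hom (f i)) -> is_hom (\sum_(i <- r | Q i) f i).
Proof.
move=> hf; elim/big_ind: _ => //; first exact: is_hom0.
by move=> g h; apply: is_homD.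
Qed.

Lemma is_submod_lker M N (f : 'Hom(M, N)) : is_hom f -> is_submod (lker f).
Proof. by move=> hf a m; rewrite !memv_ker hf => /eqP->; rewrite linear0. Qed.

Lemma is_submod_img M N (f : 'Hom(M, N)) (U : {vspace M}) :
  is_hom f -> is_submod U -> is_submod (f @: U).
Proof.
move=> hf hU a n /memv_imgP[u uU ->]; rewrite -hf.
by apply: memv_img; apply: hU.
Qed.

Lemma is_submod_full M : is_submod (fullv : {vspace M}).
Proof. by move=> a m _; rewrite memvf. Qed.

Lemma is_submod_limg M N (f : 'Hom(M, N)) : is_hom f -> is_submod (limg f).
Proof. by move=> hf; apply: is_submod_img => //; apply: is_submod_full. Qed.

(** The factor commutes with the action because th, being injective, reflects
    equalities. *)
Lemma hom_lift_inj X M N (th : 'Hom(M, N)) (h : 'Hom(X, N)) :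
  is_hom th -> lker th = 0%VS -> is_hom h -> (forall x, h x \in limg th) ->
  exists t : 'Hom(X, M), is_hom t /\ (th \o t)%VF = h.
Proof.
move=> hth kth hh sub; have inj : injective th by apply/lker0P/eqP.
have E x : th ((th^-1)%VF (h x)) = h x by rewrite limg_lfunVK.
exists (th^-1 \o h)%VF; split; last by apply/lfunP=> x; rewrite !lfE E.
by move=> a x; apply: inj; rewrite !lfE hth !E hh.
Qed.

Lemma is_iso_inj M N (f : 'Hom(M, N)) : is_iso f -> lker f = 0%VS.
Proof.
case=> hf [g [hg gf fg]]; apply/eqP/lker0P=> x y /(congr1 g).
by rewrite -!comp_lfunE gf !lfE.
Qed.

(** Surjectivity follows by counting dimensions. *)
Lemma endo_inj_iso M (f : 'Hom(M, M)) : is_hom f -> lker f = 0%VS -> is_iso f.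
Proof.
move=> hf kf; split=> //; have /eqP kf0 := kf.
have [x|t [ht E]] := hom_lift_inj hf kf (@is_hom1 M).
  by rewrite lker0_limgf ?memvf.
exists t; split=> //; apply/lfunP=> x; have /lker0P inj := kf0.
by apply: inj; rewrite -comp_lfunE comp_lfunA E !lfE.
Qed.

Lemma section_inj (M N : vectType K) (f : 'Hom(M, N)) (g : 'Hom(N, M)) :
  (g \o f = \1)%VF -> forall x, g (f x) = x.
Proof. by move=> e x; rewrite -comp_lfunE e lfE. Qed.

Lemma inj_lker (M N : vectType K) (f : 'Hom(M, N)) (g : 'Hom(N, M)) :
  (g \o f = \1)%VF -> lker f = 0%VS.
Proof. by move/section_inj=> e; apply/eqP/lker0P/(can_inj e). Qed.

(** The image of a section has the kernel of its retraction as complement,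
    so indecomposability of the target forces one of the two to vanish. *)
Lemma section_indec_iso M N (f : 'Hom(M, N)) (g : 'Hom(N, M)) :
  indecomposable N -> (exists m : M, m != 0) -> is_hom f -> is_hom g ->
  (g \o f = \1)%VF -> is_iso f.
Proof.
move=> [_ indN] [m m0] hf hg gf; have gfx := section_inj gf.
have := indN (limg f) (lker g) (is_submod_limg hf) (is_submod_lker hg).
case.
- apply/eqP; rewrite eqEsubv subvf /=; apply/subvP=> x _.
  rewrite -(subrK (f (g x)) x) addrC; apply: memv_add.
    by apply: memv_img; rewrite memvf.
  by rewrite memv_ker linearB /= gfx subrr.
- apply/eqP; rewrite -subv0; apply/subvP=> x /memv_capP[/memv_imgP[u _ ->]].
  by rewrite memv_ker gfx memv0 => /eqP->; rewrite linear0.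
- move=> f0; case/negP: m0; rewrite -(gfx m).
  have: f m \in limg f by apply: memv_img; rewrite memvf.
  by rewrite f0 memv0 => /eqP->; rewrite linear0.
- move=> kg; split=> //; exists g; split=> //; apply/lfunP=> x.
  have /lker0P inj : lker g == 0%VS by rewrite kg.
  by apply: inj; rewrite !lfE gfx.
Qed.

(** * Fitting's lemma *)

Definition lpow (V : vectType K) (phi : 'End(V)) (n : nat) : 'End(V) :=
  iter n (fun g => (phi \o g)%VF) \1%VF.

Lemma lpowE (V : vectType K) (phi : 'End(V)) n x : lpow phi n x = iter n phi x.
Proof. by elim: n => [|n IH] /=; rewrite !lfE ?IH. Qed.

Lemma is_hom_lpow M (phi : 'Hom(M, M)) n : is_hom phi -> is_hom (lpow phi n).
Proof.
by move=> h; elim: n => [|n IH] /=; [apply: is_hom1 | apply: is_hom_comp].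
Qed.

(** The dimension of the kernel of a power of phi is bounded; pick a power where
    it is maximal.  A positive exponent is needed: phi^0 and phi^(0 + 0) always
    have the same kernel, which says nothing about phi. *)
Lemma lker_pow_stable (V : vectType K) (phi : 'End(V)) :
  exists n, lker (lpow phi (n.+1 + n.+1)) = lker (lpow phi n.+1).
Proof.
pose d n := \dim (lker (lpow phi n)).
have mono m n : (lker (lpow phi m) <= lker (lpow phi (n + m)))%VS.
  apply/subvP=> x; rewrite !memv_ker !lpowE iterD => /eqP->.
  by rewrite -lpowE linear0.
have bnd n : (d n <= \dim (fullv : {vspace V}))%N by apply/dimvS/subvf.
have [n mx] : exists n, forall m, (d m <= d n)%N.
  have H k : (exists n, forall m, (d m <= d n)%N) \/ exists n, (k <= d n)%N.
    elim: k => [|k [IH|[n kn]]]; [by right; exists 0 | by left |].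
    have [|nm] := classic (exists m, (k < d m)%N); first by right.
    left; exists n => m; apply: leq_trans kn; rewrite leqNgt.
    by apply/negP=> km; apply: nm; exists m.
  by have [//|[n]] := H (\dim (fullv : {vspace V})).+1; rewrite ltnNge bnd.
exists n; apply/eqP; rewrite eq_sym eqEdim mono /=.
have dn : (d n <= d n.+1)%N by rewrite /d -(add1n n); apply/dimvS/mono.
rewrite -/(d (n.+1 + n.+1)%N) -/(d n.+1).
exact: leq_trans (mx (n.+1 + n.+1)%N) dn.
Qed.

(** Fitting's lemma: M is the direct sum of the kernel and the image of a high
    power of phi.  A nilpotent phi has no nonzero fixed point. *)
Lemma fitting M (phi : 'Hom(M, M)) : indecomposable M -> is_hom phi ->
  lker phi = 0%VS \/ forall x, phi x = x -> x = 0.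
Proof.
move=> [_ indM] hphi; have [n st] := lker_pow_stable phi.
have hn := is_hom_lpow n.+1 hphi; set psi := lpow phi n.+1 in hn st.
have cap0 : (lker psi :&: limg psi = 0)%VS.
  apply/eqP; rewrite -subv0; apply/subvP=> x /memv_capP[+ /memv_imgP[u _ xE]].
  rewrite xE memv_ker memv0 -memv_ker => psi0.
  have: u \in lker (lpow phi (n.+1 + n.+1)).
    by move: psi0; rewrite !memv_ker !lpowE iterD.
  by rewrite st memv_ker.
have := indM _ _ (is_submod_lker hn) (is_submod_limg hn); case=> //.
- apply/eqP; rewrite eqEdim subvf /= dimv_disjoint_sum //.
  by rewrite -(limg_ker_dim psi fullv) capfv.
- move=> k0; left; apply/eqP; rewrite -subv0; apply/subvP=> x.
  rewrite memv_ker memv0 => /eqP phix.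
  have: x \in lker psi by rewrite memv_ker lpowE iterSr phix -lpowE linear0.
  by rewrite k0 memv0.
- move=> i0; right=> x px.
  have: psi x \in limg psi by apply: memv_img; rewrite memvf.
  rewrite i0 memv0 lpowE => /eqP.
  by have -> : iter n.+1 phi x = x by elim: n.+1 => //= m ->.
Qed.

(** * Submodules, quotients and pullbacks *)

(** Both the submodules and the quotients of M are linear retracts V of M, with
    the action of A transported through the section sg and the retraction rh.
    The hypothesis [compress] is what makes this an action; it holds when the
    image of sg is stable and when the kernel of rh is stable. *)
Section Compression.
Variables (M : rightMod A) (V : vectType K).
Variables (sg : 'Hom(V, M)) (rh : 'Hom(M, V)).
Hypothesis rh_sg : (rh \o sg = \1)%VF.
Hypothesis compress : forall a b v,
  rh (ract M b (sg (rh (ract M a (sg v))))) = rh (ract M b (ract M a (sg v))).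

Definition compr_act1 (a : A) : 'End(V) := (rh \o (ract M a \o sg))%VF.

Fact compr_act1_is_linear : linear compr_act1.
Proof. by move=> c a b; apply/lfunP=> v; rewrite !lfE !(linearP, lfE). Qed.

HB.instance Definition _ := GRing.isSemilinear.Build K A 'End(V) _ compr_act1
  (GRing.semilinear_linear compr_act1_is_linear).

Lemma compr_actE a v : linfun compr_act1 a v = rh (ract M a (sg v)).
Proof. by rewrite lfunE /= !lfE. Qed.

Fact compr_actK1 v : linfun compr_act1 1 v = v.
Proof. by rewrite compr_actE ract1 -comp_lfunE rh_sg lfE. Qed.

Fact compr_actKM a b v :
  linfun compr_act1 (a * b) v = linfun compr_act1 b (linfun compr_act1 a v).
Proof. by rewrite !compr_actE ractM compress. Qed.

Definition comprMod : rightMod A := RightMod compr_actK1 compr_actKM.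

End Compression.

Lemma submodule_exists M (U : {vspace M}) : is_submod U ->
  exists (S : rightMod A) (io : 'Hom(S, M)),
    [/\ is_hom io, lker io = 0%VS & limg io = U].
Proof.
move=> hU; pose sg : 'Hom(subvs_of U, M) := linfun vsval.
pose rh : 'Hom(M, subvs_of U) := linfun (vsproj U).
have sgE v : sg v = vsval v by rewrite lfunE.
have rhE v : rh v = vsproj U v by rewrite lfunE.
have rs : (rh \o sg = \1)%VF.
  by apply/lfunP=> v; rewrite !lfE rhE sgE vsvalK.
have E a v : sg (rh (ract M a (sg v))) = ract M a (sg v).
  by rewrite !sgE !rhE vsprojK //; apply/hU/subvsP.
have c a b v : rh (ract M b (sg (rh (ract M a (sg v))))) =
               rh (ract M b (ract M a (sg v))) by rewrite E.
exists (comprMod rs c), sg; split.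
- by move=> a v; rewrite [ract _ _ _]compr_actE E.
- exact: inj_lker rs.
- apply/vspaceP=> x; apply/idP/idP=> [/memv_imgP[u _ ->]|xU].
    by rewrite sgE subvsP.
  apply/memv_imgP; exists (rh x); first by rewrite memvf.
  by rewrite sgE rhE vsprojK.
Qed.

(** The quotient M / U lives on a linear complement of U, with the action
    followed by the projection along U. *)
Lemma quotient_exists M (U : {vspace M}) : is_submod U ->
  exists (Q : rightMod A) (q : 'Hom(M, Q)),
    [/\ is_hom q, lker q = U & limg q = fullv].
Proof.
move=> hU; pose W := (U^C)%VS.
pose sg : 'Hom(subvs_of W, M) := linfun vsval.
pose pr : 'Hom(M, M) := daddv_pi W U.
pose rh : 'Hom(M, subvs_of W) := (linfun (vsproj W) \o pr)%VF.
have WU : (W :&: U = 0)%VS by rewrite capvC capv_compl.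
have sgE v : sg v = vsval v by rewrite lfunE.
have rhE v : rh v = vsproj W (pr v) by rewrite /rh lfE lfunE.
have srE v : sg (rh v) = pr v by rewrite rhE sgE vsprojK ?memv_pi.
have prU v : v - pr v \in U.
  have {1}<- := @daddv_pi_add _ _ W U v WU _; last first.
    by rewrite addvC addv_complf memvf.
  by rewrite addrAC subrr add0r memv_pi.
have sgi : injective sg by move=> u v; rewrite !sgE; apply: val_inj.
have rs : (rh \o sg = \1)%VF.
  apply/lfunP=> v; apply: sgi; rewrite lfE srE id_lfunE.
  by rewrite /pr daddv_pi_id // sgE subvsP.
have rhU v : (rh v == 0) = (v \in U).
  rewrite -(inj_eq sgi) srE linear0; apply/eqP/idP => [e|vU].
    by have := prU v; rewrite e subr0.
  have: pr v \in (W :&: U)%VS.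
    by rewrite memv_cap memv_pi /= -[pr v](subKr v) rpredB.
  by rewrite WU memv0 => /eqP.
have E b v : rh (ract M b (sg (rh v))) = rh (ract M b v).
  apply/eqP; rewrite -subr_eq0 -linearB /= -linearB /= rhU.
  by apply: hU; rewrite -memvN opprB srE.
have c a b v : rh (ract M b (sg (rh (ract M a (sg v))))) =
               rh (ract M b (ract M a (sg v))) by rewrite E.
exists (comprMod rs c), rh; split.
- by move=> a v; rewrite [RHS]compr_actE E.
- by apply/vspaceP=> v; rewrite memv_ker rhU.
- apply/eqP; rewrite eqEsubv subvf; apply/subvP=> v _.
  by rewrite -(section_inj rs v); apply: memv_img; rewrite memvf.
Qed.

Section DirectSum.
Variables M N : rightMod A.

Definition dsum_act2 (a : A) (u : M * N) : M * N :=
  (ract M a u.1, ract N a u.2).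

Fact dsum_act2_is_linear a : linear (dsum_act2 a).
Proof. by move=> c u v; rewrite /dsum_act2 /= !linearP. Qed.

HB.instance Definition _ a := GRing.isSemilinear.Build K (M * N)%type (M * N)%type
  _ (dsum_act2 a) (GRing.semilinear_linear (dsum_act2_is_linear a)).

Definition dsum_act1 (a : A) : 'End((M * N)%type) := linfun (dsum_act2 a).

Fact dsum_act1_is_linear : linear dsum_act1.
Proof.
move=> c a b; apply/lfunP=> u; rewrite !(lfE, lfunE) /= /dsum_act2.
by rewrite !linearP !lfE.
Qed.

HB.instance Definition _ := GRing.isSemilinear.Build K A 'End((M * N)%type) _
  dsum_act1 (GRing.semilinear_linear dsum_act1_is_linear).

Lemma dsum_actE a u : linfun dsum_act1 a u = (ract M a u.1, ract N a u.2).
Proof. by rewrite lfunE /= lfunE. Qed.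

Fact dsum_actK1 u : linfun dsum_act1 1 u = u.
Proof. by rewrite dsum_actE !ract1; case: u. Qed.

Fact dsum_actKM a b u :
  linfun dsum_act1 (a * b) u = linfun dsum_act1 b (linfun dsum_act1 a u).
Proof. by rewrite !dsum_actE !ractM. Qed.

Definition dsumMod : rightMod A := RightMod dsum_actK1 dsum_actKM.

End DirectSum.

Lemma pullback_exists X Y P (q : 'Hom(X, Y)) (f : 'Hom(P, Y)) :
  is_hom q -> is_hom f ->
  exists (R : rightMod A) (u : 'Hom(R, X)) (v : 'Hom(R, P)),
    [/\ is_hom u, is_hom v, (q \o u = f \o v)%VF
      & forall x p, q x = f p -> exists r, u r = x /\ v r = p].
Proof.
move=> hq hf.
pose p1 : 'Hom(dsumMod X P, X) := linfun (fst : X * P -> X).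
pose p2 : 'Hom(dsumMod X P, P) := linfun (snd : X * P -> P).
have p1E w : p1 w = w.1 by rewrite lfunE.
have p2E w : p2 w = w.2 by rewrite lfunE.
have h1 : is_hom p1 by move=> a m; rewrite !p1E [ract _ _ _]dsum_actE.
have h2 : is_hom p2 by move=> a m; rewrite !p2E [ract _ _ _]dsum_actE.
have hd : is_hom ((q \o p1) - (f \o p2))%VF.
  by apply: is_homB; apply: is_hom_comp.
have [R [io [hio kio iio]]] := submodule_exists (is_submod_lker hd).
exists R, (p1 \o io)%VF, (p2 \o io)%VF; split; try exact: is_hom_comp.
  apply/lfunP=> r; have: io r \in limg io by apply: memv_img; rewrite memvf.
  by rewrite iio memv_ker !lfE subr_eq0 => /eqP.
move=> x p e; have: ((x, p) : dsumMod X P) \in limg io.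
  by rewrite iio memv_ker !lfE p1E p2E e subrr.
by case/memv_imgP=> r _ E; exists r; rewrite !lfE -E p1E p2E.
Qed.

(** * Almost split maps *)

(** If g is not surjective, then the pullback of an epimorphism along a map
    starting at Y still surjects onto Y, hence does not factor through g, hence
    splits; the splitting solves the lifting problem, so Y is projective. *)
Lemma right_almost_split_onto E Y (g : 'Hom(E, Y)) :
  right_almost_split g -> ~ projective Y -> limg g = fullv.
Proof.
case=> hg _ uni np; apply: NNPP => ng; apply: np => X Z q f hq qf hf.
have [R [u [v [hu hv quv surj]]]] := pullback_exists hq hf.
have [[s [hs vs]]|nr] := classic (is_retraction v).
  exists (u \o s)%VF; split; first exact: is_hom_comp.
  by rewrite comp_lfunA quv -comp_lfunA vs comp_lfun1r.
have [w [_ gw]] := uni _ v hv nr; case: ng; apply/eqP.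
rewrite eqEsubv subvf; apply/subvP=> p _.
have: f p \in limg q by rewrite qf memvf.
case/memv_imgP=> x _ fp; have [r [_ <-]] := surj x p (esym fp).
by rewrite -gw lfE; apply: memv_img; rewrite memvf.
Qed.

Lemma epi_projective_retraction P E (g : 'Hom(E, P)) :
  projective P -> is_hom g -> limg g = fullv -> is_retraction g.
Proof.
by move=> pP hg gf; have [s [hs gs]] := pP _ _ g \1%VF hg gf (@is_hom1 P); exists s.
Qed.

(** The inclusion of the image of g in a projective P is not a retraction, so
    it factors through g; minimality makes the resulting endomorphism of E
    invertible, hence g injective. *)
Lemma right_minimal_almost_split_projective E P (g : 'Hom(E, P)) :
  right_minimal_almost_split g -> projective P -> lker g = 0%VS.
Proof.
case=> mg [hg ng uni] pP.
have [I [io [hio kio iio]]] := submodule_exists (is_submod_limg hg).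
have [|j [hj ioj]] := hom_lift_inj (h := g) hio kio hg.
  by move=> x; rewrite iio; apply: memv_img; rewrite memvf.
have [[s [hs ios]]|nr] := classic (is_retraction io).
  case: ng; apply: epi_projective_retraction => //.
  apply/eqP; rewrite -iio eqEsubv subvf; apply/subvP=> x _.
  by rewrite -(section_inj ios x); apply: memv_img; rewrite memvf.
have [t [ht gt]] := uni _ io hio nr.
have := mg (t \o j)%VF (is_hom_comp ht hj); rewrite comp_lfunA gt.
move=> /(_ ioj) /is_iso_inj ktj.
apply/eqP; rewrite -subv0 -ktj; apply/subvP=> x; rewrite !memv_ker lfE.
rewrite -ioj lfE => /eqP e.
have /lker0P inj : lker io == 0%VS by rewrite kio.
by rewrite (inj (j x) 0) ?linear0 // e linear0.
Qed.

(** Let N be the kernel of g, so f factors as io j through its inclusion io.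
    If j were not a section it would factor through f, and minimality of f would
    make an endomorphism of E with image in N invertible.  So N is the direct
    sum of the image of j and the kernel U of a retraction r of j.  The map
    E / U -> Y induced by g is not a retraction, for a splitting would yield
    a retraction of f.  So it factors through g, and minimality of g makes
    the quotient map E -> E / U injective: U = 0. *)
Lemma almost_split_exact Z E Y (f : 'Hom(Z, E)) (g : 'Hom(E, Y)) :
  left_minimal_almost_split f -> right_minimal_almost_split g ->
  limg g = fullv -> (exists y : Y, y != 0) -> (g \o f = 0)%VF ->
  lker f = 0%VS /\ lker g = limg f.
Proof.
move=> [mf [hf nsf unif]] [mg [hg nrg unig]] gf [y y0] gf0.
have g0 : exists e, g e != 0.
  have: y \in limg g by rewrite gf memvf.
  by case/memv_imgP=> e _ yE; exists e; rewrite -yE.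
have [N [io [hio kio iio]]] := submodule_exists (is_submod_lker hg).
have gio : (g \o io = 0)%VF.
  apply/lfunP=> x; have: io x \in limg io by apply: memv_img; rewrite memvf.
  by rewrite iio memv_ker !lfE => /eqP.
have [|j [hj ioj]] := hom_lift_inj (h := f) hio kio hf.
  by move=> x; rewrite iio memv_ker -comp_lfunE gf0 lfE.
have [[r [hr rj]]|nsj] := classic (is_section j); last first.
  have [t [ht tf]] := unif _ j hj nsj.
  have := mf (io \o t)%VF (is_hom_comp hio ht); rewrite -comp_lfunA tf.
  case/(_ ioj) => _ [h [_ _ ith]]; case: g0 => e /negP[].
  by rewrite -(section_inj ith e) lfE -comp_lfunE gio lfE.
have rjx := section_inj rj.
have inj_io : injective io by apply/lker0P; rewrite kio.
have ioj_x x : f x = io (j x) by rewrite -ioj lfE.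
have kf : lker f = 0%VS.
  apply/eqP/lker0P=> a b; rewrite !ioj_x => /inj_io ab.
  by rewrite -(rjx a) ab rjx.
split=> //.
pose U := (io @: lker r)%VS.
have hU : is_submod U by apply/is_submod_img/is_submod_lker.
suff U0 : U = 0%VS.
  apply/eqP; rewrite eqEsubv; apply/andP; split; last first.
    apply/subvP=> x /memv_imgP[z _ ->].
    by rewrite memv_ker -comp_lfunE gf0 lfE.
  apply/subvP=> x; rewrite -iio => /memv_imgP[k _ ->].
  suff -> : k = j (r k) by rewrite -ioj_x; apply: memv_img; rewrite memvf.
  apply/eqP; rewrite -subr_eq0 -(inj_eq inj_io) linear0 -memv0 -U0.
  by apply: memv_img; rewrite memv_ker linearB /= rjx subrr.
have [Q [q [hq kq qf]]] := quotient_exists hU.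
have gU x : x \in U -> g x = 0.
  by case/memv_imgP=> k _ ->; rewrite -comp_lfunE gio lfE.
pose g' : 'Hom(Q, Y) := (g \o q^-1)%VF.
have g'q x : g' (q x) = g x.
  rewrite lfE; apply/eqP; rewrite -subr_eq0 -linearB; apply/eqP/gU.
  rewrite -kq memv_ker linearB /= limg_lfunVK ?subrr //.
  by apply: memv_img; rewrite memvf.
have q_onto z : exists x, z = q x.
  have: z \in limg q by rewrite qf memvf.
  by case/memv_imgP=> x _ ->; exists x.
have hg' : is_hom g'.
  by move=> a z; have [x ->] := q_onto z; rewrite -hq !g'q hg.
have [[s [hs g's]]|nr] := classic (is_retraction g').
  (* 1 - s g' maps E / U to the kernel of g', which q f identifies with Z. *)
  case: nsf.
  have kqf : lker (q \o f)%VF = 0%VS.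
    apply/eqP; rewrite -subv0; apply/subvP=> z.
    rewrite memv_ker lfE memv0 -memv_ker kq => /memv_imgP[k].
    rewrite memv_ker ioj_x => /eqP rk /inj_io jk.
    by rewrite -(rjx z) jk rk.
  have hqf : is_hom (q \o f)%VF by apply: is_hom_comp.
  have hd : is_hom (q - (s \o g))%VF by apply/is_homB/is_hom_comp.
  have [|t [ht E1]] := hom_lift_inj hqf kqf hd.
    move=> x; have [x' sx] := q_onto (s (g x)).
    have: x - x' \in lker g.
      rewrite memv_ker linearB /= -[g x']g'q -sx -[g' _]comp_lfunE g's lfE.
      by rewrite subrr.
    rewrite -iio => /memv_imgP[k _ xk].
    have -> : (q - (s \o g))%VF x = (q \o f)%VF (r k).
      rewrite !lfE sx -linearB /= xk; apply/eqP; rewrite -subr_eq0 -linearB /=.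
      rewrite -memv_ker kq ioj_x -linearB.
      by apply: memv_img; rewrite memv_ker linearB /= rjx subrr.
    by apply: memv_img; rewrite memvf.
  exists t; split=> //; apply/lfunP=> z.
  have /lker0P inj : lker (q \o f)%VF == 0%VS by rewrite kqf.
  apply: inj; rewrite -comp_lfunE comp_lfunA E1 !lfE.
  by rewrite -[g (f z)]comp_lfunE gf0 lfE linear0 subr0.
have [v [hv gv]] := unig _ g' hg' nr.
have := mg (v \o q)%VF (is_hom_comp hv hq); case.
  by apply/lfunP=> x; rewrite comp_lfunA gv lfE g'q.
move=> _ [w [_ wvq _]]; apply/eqP; rewrite -subv0 -kq; apply/subvP=> x.
rewrite memv_ker memv0 => /eqP qx.
by rewrite -(section_inj wvq x) lfE qx !linear0.
Qed.

(** * The radical and its powers *)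

(** The intrinsic description of the radical: 1 - g f is injective (hence
    invertible) for every g.  Unlike [rad] it mentions no decomposition. *)
Definition jrad X Y (f : 'Hom(X, Y)) : Prop :=
  forall g : 'Hom(Y, X), is_hom g -> forall x, g (f x) = x -> x = 0.

(** Put u = 1 - g f, which is invertible.  If (g f + g f') x = x, then
    x = u^-1 g f' x, so x = 0 because f' is in the radical. *)
Lemma jradD X Y (f f' : 'Hom(X, Y)) :
  is_hom f -> jrad f -> jrad f' -> jrad (f + f').
Proof.
move=> hf jf jf' g hg x e.
have hu : is_hom (\1 - (g \o f))%VF.
  by apply: is_homB; [apply: is_hom1 | apply: is_hom_comp].
have ku : lker (\1 - (g \o f))%VF = 0%VS.
  apply/eqP; rewrite -subv0; apply/subvP=> z.
  rewrite memv_ker !lfE subr_eq0 memv0 => /eqP zE.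
  by apply/eqP/(jf g).
have [_ [k [hk ku1 _]]] := endo_inj_iso hu ku.
apply: (jf' (k \o g)%VF); first exact: is_hom_comp.
rewrite -[RHS](section_inj ku1) lfE; congr (k _).
by rewrite !lfE -{2}e !lfE linearD /= addrAC subrr add0r.
Qed.

Lemma jrad0 X Y : jrad (0 : 'Hom(X, Y)).
Proof. by move=> g _ x; rewrite lfE linear0 => <-. Qed.

Lemma jrad_comp W X Y Z (g : 'Hom(Y, Z)) (f : 'Hom(X, Y)) (h : 'Hom(W, X)) :
  is_hom g -> is_hom h -> jrad f -> jrad (g \o (f \o h))%VF.
Proof.
move=> hg hh jf k hk x; rewrite !lfE => e.
have h0 : h x = 0.
  by apply: (jf (h \o (k \o g))%VF); rewrite ?lfE ?e //; do !apply: is_hom_comp.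
by rewrite -e h0 !linear0.
Qed.

Lemma jrad_sum X Y (I : Type) (r : seq I) (Q : pred I) (f : I -> 'Hom(X, Y)) :
  (forall i, is_hom (f i)) -> (forall i, jrad (f i)) ->
  jrad (\sum_(i <- r | Q i) f i).
Proof.
move=> hf jf; elim: r => [|i r IH]; first by rewrite big_nil; apply: jrad0.
by rewrite big_cons; case: ifP => // _; apply: jradD.
Qed.

Lemma jrad_not_retraction X Y (f : 'Hom(X, Y)) :
  (exists y : Y, y != 0) -> jrad f -> ~ is_retraction f.
Proof.
move=> [y y0] jf [s [hs fs]]; case/negP: y0; have fsx := section_inj fs.
by rewrite -(fsx y) (jf s hs (s y)) ?linear0 ?fsx.
Qed.

(** By Fitting's lemma g f is an automorphism or has no fixed point; in the
    first case f is a section, hence an isomorphism. *)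
Lemma jrad_indec X Y (f : 'Hom(X, Y)) :
  indecomposable X -> indecomposable Y -> is_hom f -> ~ is_iso f -> jrad f.
Proof.
move=> iX iY hf nf g hg; have hgf := is_hom_comp hg hf.
have [k|fp] := fitting iX hgf; last by move=> x e; apply: fp; rewrite lfE.
have [_ [h [hh hgf1 _]]] := endo_inj_iso hgf k.
case: nf; apply: (@section_indec_iso _ _ _ (h \o g)%VF) => //; first by case: iX.
  exact: is_hom_comp.
by rewrite -comp_lfunA.
Qed.

Lemma comp_lfun_suml (U V W : vectType K) (I : Type) (r : seq I) (Q : pred I)
    (g : I -> 'Hom(V, W)) (f : 'Hom(U, V)) :
  ((\sum_(i <- r | Q i) g i) \o f = \sum_(i <- r | Q i) (g i \o f))%VF.
Proof.
by apply/lfunP=> x; rewrite !(lfE, sum_lfunE); apply: eq_bigr => i _; rewrite lfE.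
Qed.

Lemma comp_lfun_sumr (U V W : vectType K) (I : Type) (r : seq I) (Q : pred I)
    (g : 'Hom(V, W)) (f : I -> 'Hom(U, V)) :
  (g \o (\sum_(i <- r | Q i) f i) = \sum_(i <- r | Q i) (g \o f i))%VF.
Proof.
apply/lfunP=> x; rewrite !(lfE, sum_lfunE) linear_sum.
by apply: eq_bigr => i _; rewrite lfE.
Qed.

(** f is the sum of its components, which are non-isomorphisms between
    indecomposables, and [jrad] is closed under sums and composition. *)
Lemma rad_jrad X Y (f : 'Hom(X, Y)) : rad f -> jrad f.
Proof.
case=> hf [r [X_ [i_ [p_ [s [Y_ [j_ [q_ [[[hip _ _ ip1] iX] [[hjq _ _ jq1] iY] nI]]]]]]]]].
have -> : f = (\sum_j \sum_i (j_ j \o ((q_ j \o (f \o i_ i)) \o p_ i)))%VF.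
  rewrite -[LHS]comp_lfun1l -jq1 comp_lfun_suml; apply: eq_bigr => j _.
  rewrite -{1}[f]comp_lfun1r -ip1 !comp_lfun_sumr; apply: eq_bigr => i _.
  by rewrite !comp_lfunA.
have hc i j : is_hom (q_ j \o (f \o i_ i))%VF.
  by apply: is_hom_comp (proj2 (hjq j)) (is_hom_comp hf (proj1 (hip i))).
have hs i j : is_hom (j_ j \o ((q_ j \o (f \o i_ i)) \o p_ i))%VF.
  apply: is_hom_comp (proj1 (hjq j)) _.
  exact: is_hom_comp (proj2 (hip i)).
apply: jrad_sum => j; first by apply: is_hom_sum.
apply: jrad_sum => i //; apply: jrad_comp.
- by case: (hjq j).
- by case: (hip i).
- exact: jrad_indec.
Qed.

Lemma is_dsum1 X : is_dsum (X_ := fun _ : 'I_1 => X)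
  (fun=> \1%VF : 'Hom(X, X)) (fun=> \1%VF : 'Hom(X, X)).
Proof.
split=> [i|i|i j|]; first by split; apply: is_hom1.
- exact: comp_lfun1l.
- by rewrite !ord1.
- by rewrite big_ord1 comp_lfun1l.
Qed.

Lemma rad_indec X Y (f : 'Hom(X, Y)) :
  indecomposable X -> indecomposable Y -> is_hom f -> ~ is_iso f -> rad f.
Proof.
move=> iX iY hf nf; split=> //.
exists 1, (fun=> X), (fun=> \1%VF), (fun=> \1%VF).
exists 1, (fun=> Y), (fun=> \1%VF), (fun=> \1%VF); split.
- by split=> // ; apply: is_dsum1.
- by split=> // ; apply: is_dsum1.
- by move=> i j; rewrite comp_lfun1l comp_lfun1r.
Qed.

Lemma radn_hom n X Y (f : 'Hom(X, Y)) : radn n f -> is_hom f.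
Proof.
elim: n X Y f => [|n IH] X Y f //= [r [Z [h [g [hh hg ->]]]]].
by apply: is_hom_sum => i; apply: is_hom_comp; [apply: IH | case: (hh i)].
Qed.

Lemma radnS n X Y (f : 'Hom(X, Y)) : radn n.+1 f -> radn n f.
Proof.
elim: n X Y f => [|n IH] X Y f; first by move/radn_hom.
by case=> [r [Z [h [g [hh hg ->]]]]]; exists r, Z, h, g; split=> // i; apply: IH.
Qed.

Lemma radn_leq m n X Y (f : 'Hom(X, Y)) : (m <= n)%N -> radn n f -> radn m f.
Proof.
move=> /subnK <-; elim: (n - m)%N => // k IH /radnS; exact: IH.
Qed.

Lemma radn0 n X Y : radn n (0 : 'Hom(X, Y)).
Proof.
case: n => [|n]; first exact: is_hom0.
exists 0, (fun=> X), (fun=> 0), (fun=> 0); split=> [[]|[]|] //.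
by rewrite big_ord0.
Qed.

Lemma radnD n X Y (f g : 'Hom(X, Y)) : radn n f -> radn n g -> radn n (f + g).
Proof.
case: n => [|n]; first exact: is_homD.
move=> [r [Z [h [k [hh hk ->]]]]] [r' [Z' [h' [k' [hh' hk' ->]]]]].
pose Z2 (u : 'I_r + 'I_r') := match u with inl i => Z i | inr i => Z' i end.
pose h2 u : 'Hom(X, Z2 u) := match u with inl i => h i | inr i => h' i end.
pose k2 u : 'Hom(Z2 u, Y) := match u with inl i => k i | inr i => k' i end.
exists (r + r')%N, (fun i => Z2 (split i)), (fun i => h2 (split i)),
  (fun i => k2 (split i)); split.
- by move=> i; case: (split i).
- by move=> i; case: (split i).
- rewrite big_split_ord /=; congr (_ + _); apply: eq_bigr => i _.
    by rewrite -[lshift _ _]/(unsplit (inl i)) unsplitK.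
  by rewrite -[rshift _ _]/(unsplit (inr i)) unsplitK.
Qed.

Lemma radn_comp n X Y Z (g : 'Hom(Y, Z)) (f : 'Hom(X, Y)) :
  is_hom g -> radn n f -> radn n (g \o f)%VF.
Proof.
elim: n X Y Z g f => [|n IH] X Y Z g f hg; first exact: is_hom_comp.
case=> [r [W [h [k [hh hk ->]]]]]; exists r, W, h, (fun i => g \o k i)%VF.
split=> [i|i|]; [exact: hh | exact: IH hg (hk i) |].
by rewrite comp_lfun_sumr; apply: eq_bigr => i _; rewrite comp_lfunA.
Qed.

Lemma radnZ n X Y c (f : 'Hom(X, Y)) : radn n f -> radn n (c *: f).
Proof.
move=> rf; have -> : c *: f = ((c *: \1) \o f)%VF.
  by apply/lfunP=> x; rewrite !lfE.
by apply: radn_comp => //; apply/is_homZ/is_hom1.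
Qed.

Lemma radnN n X Y (f : 'Hom(X, Y)) : radn n f -> radn n (- f).
Proof. by rewrite -scaleN1r; apply: radnZ. Qed.

Lemma radnB n X Y (f g : 'Hom(X, Y)) : radn n f -> radn n g -> radn n (f - g).
Proof. by move=> rf rg; apply/radnD/radnN. Qed.

Lemma radn_sum n X Y (I : Type) (r : seq I) (Q : pred I) (f : I -> 'Hom(X, Y)) :
  (forall i, Q i -> radn n (f i)) -> radn n (\sum_(i <- r | Q i) f i).
Proof.
move=> rf; elim/big_ind: _ => //; first exact: radn0.
by move=> g h; apply: radnD.
Qed.

Lemma radn_rad n X Y Z (g : 'Hom(Y, Z)) (f : 'Hom(X, Y)) :
  radn n g -> rad f -> radn n.+1 (g \o f)%VF.
Proof.
by move=> rg rf; exists 1, (fun=> Y), (fun=> f), (fun=> g); rewrite big_ord1.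
Qed.

(** A power of the radical is in the radical, by absorbing the other factors. *)
Lemma radnS_jrad n X Y (f : 'Hom(X, Y)) : radn n.+1 f -> jrad f.
Proof.
move=> [r [Z [h [g [hh hg ->]]]]].
have hgi i : is_hom (g i) := radn_hom (hg i).
apply: jrad_sum => i; first by apply: is_hom_comp; case: (hh i).
rewrite -[h i]comp_lfun1r; apply: jrad_comp => //; first exact: is_hom1.
exact: rad_jrad.
Qed.

(** Powers of the radical are peeled off at the source, so the tails of the
    composites factor through g by induction; a single radical map does because
    it is no retraction. *)
Lemma radnS_factor n X E Y (g : 'Hom(E, Y)) (f : 'Hom(X, Y)) :
  (exists y : Y, y != 0) -> right_almost_split g -> radn n.+1 f ->
  exists t : 'Hom(X, E), radn n t /\ (g \o t)%VF = f.
Proof.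
move=> ny [hg _ uni]; elim: n X f => [|n IH] X f rf.
  have [t [ht gt]] := uni _ _ (radn_hom rf)
    (jrad_not_retraction ny (radnS_jrad rf)).
  by exists t.
case: rf => [r [Z [h [k [hh hk ->]]]]].
have [t /all_and2[rt kt]] := fin_all_exists (fun i => IH _ _ (hk i)).
exists (\sum_i (t i \o h i))%VF; split; first by exists r, Z, h, t.
by rewrite comp_lfun_sumr; apply: eq_bigr => i _; rewrite comp_lfunA kt.
Qed.

(** * Direct sums *)

Lemma left_minimal_almost_split_iso X E E' (f : 'Hom(X, E)) (p : 'Hom(E, E')) :
  is_iso p -> left_minimal_almost_split f ->
  left_minimal_almost_split (p \o f)%VF.
Proof.
move=> [hp [p' [hp' p'p pp']]] [mf [hf nf uni]]; split.
  move=> h hh e.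
  have hphp : is_hom ((p' \o h) \o p)%VF by do !apply: is_hom_comp.
  have [|_ [k [hk k1 k2]]] := mf _ hphp.
    by rewrite -!comp_lfunA e comp_lfunA p'p comp_lfun1l.
  have pp'x := section_inj pp'.
  have k1x y : k (p' (h (p y))) = y by have := section_inj k1 y; rewrite !lfE.
  have k2x y : p' (h (p (k y))) = y by have := section_inj k2 y; rewrite !lfE.
  split=> //; exists ((p \o k) \o p')%VF; split; first by do !apply: is_hom_comp.
    by apply/lfunP=> x; rewrite !lfE -{1}(pp'x x) k1x.
  by apply/lfunP=> x; rewrite !lfE -[h _]pp'x k2x.
split.
- exact: is_hom_comp.
- case=> g [hg e]; apply: nf; exists (g \o p)%VF; rewrite -comp_lfunA.
  by split=> //; apply: is_hom_comp.
- move=> Y u hu nu; have [v [hv vf]] := uni _ u hu nu.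
  exists (v \o p')%VF; split; first exact: is_hom_comp.
  by rewrite comp_lfunA -(comp_lfunA v) p'p comp_lfun1r.
Qed.

Lemma dsum_iso r (X_ : 'I_r -> rightMod A) E E'
    (i_ : forall i, 'Hom(X_ i, E)) (p_ : forall i, 'Hom(E, X_ i))
    (i_' : forall i, 'Hom(X_ i, E')) (p_' : forall i, 'Hom(E', X_ i)) :
  is_dsum i_ p_ -> is_dsum i_' p_' -> is_iso (\sum_i (i_' i \o p_ i))%VF.
Proof.
have dsum_comp M N (a_ : forall i, 'Hom(X_ i, M)) (b_ : forall i, 'Hom(M, X_ i))
    (a_' : forall i, 'Hom(X_ i, N)) (b_' : forall i, 'Hom(N, X_ i)) :
  is_dsum a_ b_ -> is_dsum a_' b_' ->
  ((\sum_i (a_ i \o b_' i)) \o (\sum_i (a_' i \o b_ i)) = \1)%VF.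
  move=> [_ _ _ <-] [_ ba1 ba0 _]; rewrite comp_lfun_suml; apply: eq_bigr => i _.
  rewrite comp_lfun_sumr (bigD1 i) //= big1 => [|j ji].
    by rewrite addr0 comp_lfunA -(comp_lfunA (a_ i)) ba1 comp_lfun1r.
  by rewrite comp_lfunA -(comp_lfunA (a_ i)) ba0 // comp_lfun0r comp_lfun0l.
move=> ds ds'; have [h _ _ _] := ds; have [h' _ _ _] := ds'.
split; first by apply: is_hom_sum => i; apply: is_hom_comp; case: (h i); case: (h' i).
exists (\sum_i (i_ i \o p_' i))%VF; split; try exact: dsum_comp.
by apply: is_hom_sum => i; apply: is_hom_comp; case: (h i); case: (h' i).
Qed.

Lemma dsum_projK r (X_ : 'I_r -> rightMod A) E X
    (i_ : forall i, 'Hom(X_ i, E)) (p_ : forall i, 'Hom(E, X_ i))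
    (w : forall i, 'Hom(X, X_ i)) i :
  is_dsum i_ p_ -> (p_ i \o (\sum_j (i_ j \o w j)) = w i)%VF.
Proof.
move=> [_ pi1 pi0 _]; rewrite comp_lfun_sumr (bigD1 i) //= big1 => [|j ji].
  by rewrite addr0 comp_lfunA pi1 comp_lfun1l.
by rewrite comp_lfunA pi0 // comp_lfun0l.
Qed.

Lemma dsum_rowK r (X_ : 'I_r -> rightMod A) E X Y
    (i_ : forall i, 'Hom(X_ i, E)) (p_ : forall i, 'Hom(E, X_ i))
    (g : forall i, 'Hom(X_ i, Y)) (w : forall i, 'Hom(X, X_ i)) :
  is_dsum i_ p_ ->
  ((\sum_i (g i \o p_ i)) \o (\sum_i (i_ i \o w i)) = \sum_i (g i \o w i))%VF.
Proof.
move=> ds; rewrite comp_lfun_suml; apply: eq_bigr => i _.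
by rewrite -comp_lfunA dsum_projK.
Qed.

End Modules.

(** * Homogeneous maps *)

Lemma closed_eigenvector (K : closedFieldType) (V : vectType K) (phi : 'End(V)) :
  (exists v : V, v != 0) -> exists c (v : V), v != 0 /\ phi v = c *: v.
Proof.
move=> [v0 nz]; have dV : (0 < \dim (fullv : {vspace V}))%N.
  rewrite lt0n dimv_eq0; apply/negP=> /eqP d0; case/negP: nz.
  by rewrite -memv0 -d0 memvf.
pose e := vbasis (fullv : {vspace V}).
have eb : basis_of fullv e by apply: vbasisP.
have /closed_rootP[c] : size (char_poly (passmx.mxof e e phi)) != 1%N.
  by rewrite size_char_poly eqSS -lt0n.
rewrite -eigenvalue_root_char => /eigenvalueP[u uE u0].
exists c, (passmx.vecof e u); split; first by rewrite passmx.vecof_eq0.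
have /eqP z0 : passmx.vecof e 0 == 0 by rewrite passmx.vecof_eq0.
by rewrite (passmx.hom_vecof e eb) uE -[c *: u]addr0 passmx.vecof_linear z0 addr0.
Qed.

Section Component.
Variables (K : closedFieldType) (A : falgType K) (G : AR_component A).
Variable F : riedtmann_functor G.
Implicit Types (x y z : G) (n : nat).

Local Arguments radn {K A} n {X Y} f : simpl never.

Definition arrow_map x y (a : arr x y) : 'Hom(vmod x, vmod y) :=
  F x y (pathArr a).

(** Kronecker delta of the component: a uniform name for the generator of the
    degree 0 part, whether or not x and y coincide. *)
Definition idm x y : 'Hom(vmod x, vmod y) :=
  match x =P y with
  | ReflectT e => ecast w 'Hom(vmod x, vmod w) e \1%VF
  | ReflectF _ => 0
  end.

Lemma idm_id x : idm x x = \1%VF.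
Proof. by rewrite /idm; case: eqP => // e; rewrite eq_axiomK. Qed.

Lemma idm_neq x y : x <> y -> idm x y = 0.
Proof. by rewrite /idm; case: eqP. Qed.

(** The image under F of the degree n part of the mesh category.  Maps of degree
    n + 1 are expanded along the last arrow.  Asking for the expansion along
    every enumeration of the arrows into y, each arrow occurring exactly once,
    collects the terms with the same last arrow once and for all. *)
Fixpoint homog n x y (f : 'Hom(vmod x, vmod y)) : Prop :=
  if n is n'.+1 then
    forall r (e : 'I_r -> {z : G & arr z y}), bijective e ->
      exists w : forall i, 'Hom(vmod x, vmod (tag (e i))),
        (forall i, homog n' (w i)) /\
        f = (\sum_i (arrow_map (tagged (e i)) \o w i))%VF
  else exists c, f = c *: idm x y.

Lemma vmod_neq0 x : exists v : vmod x, v != 0.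
Proof. by case: (vmod_indec x). Qed.

Lemma homog0 n x y : homog n (0 : 'Hom(vmod x, vmod y)).
Proof.
elim: n x y => [|n IH] x y; first by exists 0; rewrite scale0r.
move=> r e _; exists (fun=> 0); split=> [i|]; first exact: IH.
by rewrite big1 // => i _; rewrite comp_lfun0r.
Qed.

Lemma homog_lin n x y c (f g : 'Hom(vmod x, vmod y)) :
  homog n f -> homog n g -> homog n (c *: f + g).
Proof.
elim: n x y f g => [|n IH] x y f g.
  by move=> [a ->] [b ->]; exists (c * a + b); rewrite scalerDl scalerA.
move=> df dg r e be; have [w [dw ->]] := df r e be; have [u [du ->]] := dg r e be.
exists (fun i => c *: w i + u i); split=> [i|].
  exact: IH (dw i) (du i).
rewrite scaler_sumr -big_split /=; apply: eq_bigr => i _.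
by rewrite comp_lfunDr comp_lfunZr.
Qed.

Lemma homogD n x y (f g : 'Hom(vmod x, vmod y)) :
  homog n f -> homog n g -> homog n (f + g).
Proof. by rewrite -{2}[f]scale1r; apply: homog_lin. Qed.

Lemma homogN n x y (f : 'Hom(vmod x, vmod y)) : homog n f -> homog n (- f).
Proof.
rewrite -scaleN1r -[_ *: f]addr0 => df.
exact: homog_lin df (homog0 _ _ _).
Qed.

Lemma homog_sum n x y (I : Type) (r : seq I) (Q : pred I)
    (f : I -> 'Hom(vmod x, vmod y)) :
  (forall i, homog n (f i)) -> homog n (\sum_(i <- r | Q i) f i).
Proof.
move=> df; elim/big_ind: _ => //; first exact: homog0.
by move=> g h; apply: homogD.
Qed.

(** A single arrow is the expansion whose other coefficients vanish. *)
Lemma homog_comp_arrow n x y z (a : arr y z) (f : 'Hom(vmod x, vmod y)) :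
  homog n f -> homog n.+1 (arrow_map a \o f)%VF.
Proof.
move=> df r e [d ed de].
suff H (u : {w : G & arr w z}) (h : 'Hom(vmod x, vmod (tag u))) : homog n h ->
    exists w : forall i, 'Hom(vmod x, vmod (tag (e i))),
      (forall i, homog n (w i)) /\ (arrow_map (tagged u) \o h =
                                  \sum_i (arrow_map (tagged (e i)) \o w i))%VF.
  exact: (H (Tagged (fun w => arr w z) a)).
rewrite -(de u) in h *; move: (d u) h => i h dh.
exists (dfwith (fun j => 0 : 'Hom(vmod x, vmod (tag (e j)))) h); split=> [j|].
  by case: dfwithP => // k _; apply: homog0.
rewrite (bigD1 i) //= dfwith_in big1 ?addr0 // => j ji.
by rewrite dfwith_out ?comp_lfun0r // eq_sym.
Qed.

Lemma homog_arrow_comp n x y z (a : arr x y) (f : 'Hom(vmod y, vmod z)) :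
  homog n f -> homog n.+1 (f \o arrow_map a)%VF.
Proof.
elim: n z f => [|n IH] z f.
  case=> c ->; case: (classic (y = z)) => [yz|/idm_neq->]; last first.
    by rewrite scaler0 comp_lfun0l; apply: homog0.
  case: z / yz {f}; rewrite idm_id -comp_lfunZl comp_lfun1l.
  have -> : c *: arrow_map a = (arrow_map a \o (c *: idm x x))%VF.
    by rewrite idm_id -comp_lfunZr comp_lfun1r.
  by apply: homog_comp_arrow; exists c.
move=> df r e be; have [w [dw ->]] := df r e be.
exists (fun i => w i \o arrow_map a)%VF; split=> [i|]; first exact: IH (dw i).
by rewrite comp_lfun_suml; apply: eq_bigr => i _; rewrite comp_lfunA.
Qed.

Lemma arrow_map_hom x y (a : arr x y) : is_hom (arrow_map a).
Proof. exact: rf_hom. Qed.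

Lemma arrow_map_rad x y (a : arr x y) : rad (arrow_map a).
Proof.
apply: rad_indec; try exact: vmod_indec; first exact: arrow_map_hom.
have [r [e be]] := ar_in_finite y; have [d ed de] := be.
suff H i : ~ is_iso (arrow_map (tagged (e i))).
  by have := H (d (Tagged (fun w => arr w y) a)); rewrite de.
have [E [i_ [p_ [ds [_ [hg ng _]]]]]] := rf_right F be.
case=> _ [k [hk _ ak]]; apply: ng; exists (i_ i \o k)%VF.
have [hip _ _ _] := ds; split; first by apply: is_hom_comp => //; case: (hip i).
rewrite -[RHS]ak comp_lfunA; congr (_ \o _)%VF.
rewrite comp_lfun_suml (bigD1 i) //= big1 => [|j ji].
  by case: ds => _ pi1 _ _; rewrite -comp_lfunA pi1 comp_lfun1r addr0.
by case: ds => _ _ pi0 _; rewrite -comp_lfunA pi0 ?comp_lfun0r // eq_sym.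
Qed.

(** Homogeneous maps are expanded at the target, but powers of the radical at
    the source; so the induction lets h absorb the arrows of f one by one. *)
Lemma radn_comp_homog m n x y (Y : rightMod A) (h : 'Hom(vmod y, Y))
    (f : 'Hom(vmod x, vmod y)) :
  radn m h -> homog n f -> radn (n + m) (h \o f)%VF.
Proof.
elim: n m y h f => [|n IH] m y h f rh.
  case=> c ->; case: (classic (x = y)) => [xy|/idm_neq->]; last first.
    by rewrite scaler0 comp_lfun0r; apply: radn0.
  case: y / xy {f} h rh => h rh.
  by rewrite idm_id -comp_lfunZr comp_lfun1r; apply: radnZ.
move=> df; have [r [e be]] := ar_in_finite y; have [w [dw ->]] := df r e be.
rewrite comp_lfun_sumr; apply: radn_sum => i _; rewrite comp_lfunA addSnnS.
exact: IH (radn_rad rh (arrow_map_rad _)) (dw i).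
Qed.

Lemma homog_radn n x y (f : 'Hom(vmod x, vmod y)) : homog n f -> radn n f.
Proof.
move=> df; rewrite -(addn0 n) -[f]comp_lfun1l.
by apply: radn_comp_homog => //; apply: is_hom1.
Qed.

Lemma homog_hom n x y (f : 'Hom(vmod x, vmod y)) : homog n f -> is_hom f.
Proof. by move/homog_radn/radn_hom. Qed.

(** Subtracting an eigenvalue destroys injectivity; and a section between
    different vertices would be an isomorphism. *)
Lemma scalar_mod_nonsection x y (s : 'Hom(vmod x, vmod y)) : is_hom s ->
  exists c, ~ is_section (s - c *: idm x y).
Proof.
move=> hs; case: (classic (x = y)) => [xy|nxy]; last first.
  exists 0; rewrite scale0r subr0 => -[g [hg gs]]; apply/nxy/vmod_inj.
  exists s; apply: section_indec_iso gs => //; first exact: vmod_indec.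
  exact: vmod_neq0.
case: y / xy s hs => s _.
have [c [v [v0 sv]]] := closed_eigenvector s (vmod_neq0 x).
exists c => -[g [_ gs]]; case/negP: v0; rewrite -(section_inj gs v).
by rewrite idm_id !lfE sv subrr linear0.
Qed.

(** Remove a scalar so that s is no section; then s factors through the left
    almost split map out of x, and the factors are approximated recursively. *)
Lemma graded_approximation m x y (s : 'Hom(vmod x, vmod y)) : is_hom s ->
  exists s_ : nat -> 'Hom(vmod x, vmod y),
    (forall j, homog j (s_ j)) /\ radn m (s - \sum_(j < m) s_ j).
Proof.
elim: m x s => [|m IH] x s hs.
  exists (fun=> 0); split=> [j|]; first exact: homog0.
  by rewrite big_ord0 subr0.
have [c nsec] := scalar_mod_nonsection hs.
have [r [e be]] := ar_out_finite x.
have [E [i_ [p_ [[hip _ _ _] [_ [_ _ uni]]]]]] := rf_left F be.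
have h1 : is_hom (idm x y) by apply: (@homog_hom 0); exists 1; rewrite scale1r.
have hd : is_hom (s - c *: idm x y) by apply: is_homB => //; apply: is_homZ.
have [v [hv vE]] := uni _ _ hd nsec.
have hvi i : is_hom (v \o i_ i)%VF by apply: is_hom_comp => //; case: (hip i).
have [t /all_and2[dt rt]] := fin_all_exists (fun i => IH _ _ (hvi i)).
exists (fun j => if j is j'.+1 then
    (\sum_i (t i j' \o arrow_map (tagged (e i))))%VF else c *: idm x y).
split=> [[|j]|]; first by exists c.
  by apply: homog_sum => i; apply: homog_arrow_comp.
rewrite big_ord_recl /= opprD addrA -vE comp_lfun_sumr exchange_big /= -sumrB.
apply: radn_sum => i _; rewrite comp_lfunA -comp_lfun_suml.
rewrite -comp_lfunNl -comp_lfunDl.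
by apply: radn_rad => //; apply: arrow_map_rad.
Qed.

(** F is injective on degree n modulo rad^(n+1). *)
Definition homog_separated n := forall x y (f : 'Hom(vmod x, vmod y)),
  homog n f -> radn n.+1 f -> f = 0.

(** Once the terms of degree below j vanish, the term of degree j is in
    rad^(j+1), like the whole sum and the terms of higher degree. *)
Lemma graded_independent n x y (v : nat -> 'Hom(vmod x, vmod y)) :
  (forall j, (j < n)%N -> homog_separated j) -> (forall j, homog j (v j)) ->
  radn n (\sum_(j < n) v j) -> forall j, (j < n)%N -> v j = 0.
Proof.
move=> sep dv rv; elim/ltn_ind=> j IH jn; apply: (sep j jn) => //.
pose o := Ordinal jn.
have -> : v j = \sum_(i < n) v i - \sum_(i < n | i != o) v i.
  by rewrite (bigD1 o) //= addrK.
apply: radnB; first exact: radn_leq rv.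
apply: radn_sum => i io; have [ij|] := ltnP i j.
  by rewrite IH //; apply: radn0.
rewrite leq_eqVlt => /orP[/eqP ji|ji]; first by case/negP: io; apply/eqP/val_inj.
by apply: radn_leq ji _; apply: homog_radn.
Qed.

(** * Exactness of meshes *)

Lemma sigma_total_bij y z (ty : ar_tau y = Some z) :
  bijective (fun u : {w : G & arr w y} =>
    Tagged (fun w => arr z w) (ar_sigma ty (tagged u))).
Proof.
have ex w (b : arr z w) : exists a : arr w y, ar_sigma ty a == b.
  by have [k _ bk] := ar_sigma_bij ty w; exists (k b); rewrite bk.
exists (fun u : {w : G & arr z w} =>
  Tagged (fun w => arr w y) (xchoose (ex _ (tagged u)))).
- move=> [w a] /=; congr (Tagged _); apply: (bij_inj (ar_sigma_bij ty w)).
  exact/eqP/(xchooseP (ex _ _)).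
- by move=> [w b] /=; congr (Tagged _); apply/eqP/(xchooseP (ex _ _)).
Qed.

Lemma rf0 x y : F x y 0 = 0.
Proof.
have := rf_linear F (-1) (0 : pathHom x y) 0.
by rewrite scaler0 addr0 scaleN1r addNr.
Qed.

Lemma rfD x y (u v : pathHom x y) : F x y (u + v) = F x y u + F x y v.
Proof. by rewrite -{1}[u]scale1r rf_linear scale1r. Qed.

Lemma mesh_zero y z (ty : ar_tau y = Some z) r (e : 'I_r -> {w : G & arr w y}) :
  bijective e ->
  (\sum_i (arrow_map (tagged (e i)) \o
    arrow_map (ar_sigma ty (tagged (e i)) : arr z (tag (e i)))) = 0)%VF.
Proof.
move=> be; rewrite -[RHS](rf0 z y).
have <- : F z y (mesh_rel ty e) = F z y 0.
  by apply: rf_mesh; rewrite /mesh_eq subr0; apply: mesh_ideal_rel.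
rewrite (big_morph (F z y) (@rfD z y) (rf0 z y)).
by apply: eq_bigr => i _; rewrite rf_comp.
Qed.

Lemma mesh_exact y z (ty : ar_tau y = Some z) r (e : 'I_r -> {w : G & arr w y})
    (E : rightMod A) (i_ : forall i, 'Hom(vmod (tag (e i)), E))
    (p_ : forall i, 'Hom(E, vmod (tag (e i)))) :
  bijective e -> is_dsum i_ p_ ->
  let phi := (\sum_i (i_ i \o
     arrow_map (ar_sigma ty (tagged (e i)) : arr z (tag (e i)))))%VF in
  let g := (\sum_i (arrow_map (tagged (e i)) \o p_ i))%VF in
  right_minimal_almost_split g ->
  [/\ is_hom phi, (g \o phi = 0)%VF, lker phi = 0%VS & lker g = limg phi].
Proof.
move=> be ds phi g rg.
have [E' [i' [p' [ds' lf]]]] := rf_left F (bij_comp (sigma_total_bij ty) be).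
have lphi : left_minimal_almost_split phi.
  have := left_minimal_almost_split_iso (dsum_iso ds' ds) lf.
  by rewrite (dsum_rowK _ _ ds').
have gphi : (g \o phi = 0)%VF by rewrite /g /phi (dsum_rowK _ _ ds) mesh_zero.
have np : ~ projective (vmod y) by move/ar_tau_proj; rewrite ty.
have [|k1 k2] := almost_split_exact lphi rg _ (vmod_neq0 y) gphi.
  by case: rg => _ rg; apply: right_almost_split_onto.
by split=> //; case: lphi => _ [].
Qed.

(** * Separation of degrees *)

(** Both W and t lift f through g: W is homogeneous of degree m, whereas t is in
    rad^(m+1).  They differ by an element of the kernel of g, which the structure
    of the mesh ending at y describes. *)
Lemma homog_separation n : homog_separated n.
Proof.
elim/ltn_ind: n => -[_|m sep] x y f.
  case=> c ->; case: (classic (x = y)) => [xy|/idm_neq->]; last first.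
    by rewrite scaler0.
  case: y / xy {f} => r1; have [->|c0] := eqVneq c 0; first by rewrite scale0r.
  have [v v0] := vmod_neq0 x; case/negP: v0; apply/eqP.
  apply: (radnS_jrad r1 (is_homZ c^-1 (@is_hom1 _ _ (vmod x)))).
  by rewrite idm_id !lfE scalerA mulVf // scale1r.
have [r [e be]] := ar_in_finite y.
move=> df rf; have [w [dw fE]] := df r e be.
have [E [i_ [p_ [ds rg]]]] := rf_right F be.
set g := (\sum_i _)%VF in rg.
have [hip _ _ _] := ds.
pose W := (\sum_i (i_ i \o w i))%VF.
have gW : (g \o W)%VF = f by rewrite /g /W (dsum_rowK _ _ ds) fE.
have pW i : (p_ i \o W)%VF = w i by apply: dsum_projK.
have hW : is_hom W.
  by apply: is_hom_sum => i; apply: is_hom_comp (homog_hom (dw i)); case: (hip i).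
have [t [rt gt]] := radnS_factor (vmod_neq0 y) (proj2 rg) rf.
have rpt i : radn m.+1 (p_ i \o t)%VF by apply: radn_comp => //; case: (hip i).
have gWt v : g (W v) = g (t v) by rewrite -!comp_lfunE gW gt.
case ty : (ar_tau y) => [z|]; last first.
  have /ar_tau_proj py := ty.
  have /eqP/lker0P inj := right_minimal_almost_split_projective rg py.
  have Wt : W = t by apply/lfunP=> v; apply: inj.
  rewrite fE big1 // => i _.
  have -> : w i = 0 by apply: (sep m (ltnSn m) _ _ _ (dw i)); rewrite -pW Wt.
  exact: comp_lfun0r.
have [] := mesh_exact ty be ds rg.
set phi := (\sum_i _)%VF => hphi gphi kphi kg.
have hWt : is_hom (W - t) by apply: is_homB => //; apply: radn_hom rt.
have [|s [hs phis]] := hom_lift_inj hphi kphi hWt.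
  by move=> v; rewrite -kg memv_ker !lfE linearB /= gWt subrr.
have [s_ [ds_ rs]] := graded_approximation m.+1 hs.
pose b i : 'Hom(vmod z, vmod (tag (e i))) :=
  arrow_map (ar_sigma ty (tagged (e i)) : arr z (tag (e i))).
(* the part of s of degree m - 1, absent when m = 0 *)
pose s1 := if m is m'.+1 then s_ m' else 0.
suff wE i : w i = (b i \o s1)%VF.
  have -> : f = ((g \o phi) \o s1)%VF.
    rewrite /g /phi (dsum_rowK _ _ ds) fE comp_lfun_suml.
    by apply: eq_bigr => i _; rewrite wE comp_lfunA.
  by rewrite gphi comp_lfun0l.
have pphi : (p_ i \o phi)%VF = b i by apply: dsum_projK.
(* v j is the degree j part of W - phi s at the component i *)
pose v j := (if j == m then w i else 0) -
            (if j is j'.+1 then (b i \o s_ j')%VF else 0).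
have dv j : homog j (v j).
  apply: homogD; first by case: eqP => [->|_]; [apply: dw | apply: homog0].
  apply: homogN; case: j => [|j]; first exact: homog0.
  exact: homog_comp_arrow.
have vsum : \sum_(j < m.+1) v j = w i - (b i \o \sum_(j < m) s_ j)%VF.
  rewrite sumrB big_ord_recr /= eqxx big1 ?add0r => [|j _]; last first.
    by rewrite ltn_eqF.
  by rewrite big_ord_recl /= add0r comp_lfun_sumr.
have rv : radn m.+1 (\sum_(j < m.+1) v j).
  have hb : is_hom (b i) by apply: arrow_map_hom.
  have -> : \sum_(j < m.+1) v j = (p_ i \o t)%VF
      + ((b i \o (s - \sum_(j < m.+1) s_ j))%VF + (b i \o s_ m)%VF).
    rewrite vsum -comp_lfunDr big_ord_recr /= opprD addrA subrK.
    rewrite comp_lfunDr comp_lfunNr addrA; congr (_ - _).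
    by rewrite -pphi -comp_lfunA phis -pW -comp_lfunDr addrC subrK.
  apply: radnD => //; apply: radnD; first exact: radn_comp.
  exact/homog_radn/homog_comp_arrow.
have /eqP := graded_independent sep dv rv (ltnSn m).
rewrite /v eqxx subr_eq0 => /eqP->; rewrite /s1.
by case: (m) => [|m']; rewrite ?comp_lfun0r.
Qed.

Lemma homog_comp_chain (X : nat -> G)
    (f : forall i : nat, 'Hom(vmod (X i), vmod (X i.+1))) n :
  (forall i, (i < n)%N -> chosen F (f i)) -> homog n (comp_chain f n).
Proof.
elim: n => [|n IH] cf /=; first by exists 1; rewrite idm_id scale1r.
have [a ->] := cf n (ltnSn n); apply: homog_comp_arrow.
by apply: IH => i lin; apply: cf; apply: ltnW.
Qed.

End Component.

Theorem corollary2p5 (K : closedFieldType) (A : falgType K)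
    (G : AR_component A) (F : riedtmann_functor G)
    (n : nat) (n_gt0 : (0 < n)%N)
    (X : nat -> G) (f : forall i : nat, 'Hom(vmod (X i), vmod (X i.+1))%type)
    (f_chosen : forall i : nat, (i < n)%N -> chosen F (f i)) :
  (radn n (comp_chain f n) /\ ~ radn n.+1 (comp_chain f n))
  \/ comp_chain f n = 0%R.
Proof.
have df := homog_comp_chain f_chosen.
case: (classic (radn n.+1 (comp_chain f n))) => [rf|nrf].
  by right; apply: homog_separation df rf.
by left; split=> //; apply: homog_radn df.
Qed.
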